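(* Let $n\ge3$ and let $\lambda=(\lambda_1,\lambda_2)$ be a two-row partition of $n$ ($\lambda_1\ge\lambda_2\ge1$). Then $U(\overline\Gamma_\lambda)=\overline{\mathcal D}_\lambda$ as $[1,n]$-labeled graphs.
   Context: **Conventions.** For $k\in\mathbb Z$, $\overline{k}$ is the unique element of $\{1,\dots,n\}$ congruent to $k$ modulo $n$; $[1,n]=\{1,\dots,n\}$. For $a,b\in[1,n]$, $\langle a,b\rangle$ is $\emptyset$ if $a=\overline{b+1}$, and otherwise the cyclic interval $\{a,\overline{a+1},\dots,b\}$. **Tableaux.** $\mathrm{RSYT}(\lambda)$ is the set of fillings of the Young diagram of $\lambda$ (English convention) by $1,\dots,n$, each used once, with rows increasing; $T^1$ (top row), $T^2$ are the rows of $T$, regarded as sets. Interchanging entries is followed by re-sorting rows. $\overline{\mathrm{des}}(T)=\{i\in[1,n]\mid i\text{ lies in a strictly higher row of }T\text{ than }\overline{i+1}\}$. $T,T'$ are connected by a Knuth move if $\overline{\mathrm{des}}(T),\overline{\mathrm{des}}(T')$ are incomparable under inclusion and $T'$ is obtained from $T$ by interchanging $\overline i$ and $\overline{i+1}$ for some $i$. **Labeled graphs.** A $[1,n]$-labeled graph is a triple $(V,m,\tau)$ with $m:V\times V\to\mathbb Z[q^{\pm1/2}]$ (written $m(u\triangleright v)$) and $\tau:V\to\{\text{subsets of }[1,n]\}$ (locally finite). Its simple underlying graph $U(\Gamma)$ has the same $V,\tau$, and weight $m'$ with $m'(u\triangleright v)=m'(v\triangleright u)=1$ if $m(u\triangleright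 v)=m(v\triangleright u)=1$, and $m'(u\triangleright v)=m'(v\triangleright u)=0$ otherwise. **The graph $\overline{\mathcal D}_\lambda$** (affine dual equivalence graph). Vertex set $\mathrm{RSYT}(\lambda)$, $\tau=\overline{\mathrm{des}}$, $m(u\triangleright v)=m(v\triangleright u)=1$ if $u,v$ are connected by a Knuth move, $0$ otherwise. **The graph $\overline\Gamma_\lambda$.** The $[1,n]$-labeled graph $(\mathrm{RSYT}(\lambda),m,\overline{\mathrm{des}})$ with $m\in\{0,1\}$ and $m(s\triangleright t)=1$ iff: (first kind) $t$ is obtained from $s$ by interchanging $\overline i\in s^1$ and $\overline{i+1}\in s^2$; or (second kind) $t$ is obtained from $s$ by interchanging $\overline i\in s^2$ and $\overline j\in s^1$, $\overline i\ne\overline{j+1}$, where $\overline{j-i}$ is odd; $\overline{i+1}\in s^1$ and $\overline{j-1}\in s^2$; $\overline{i-1}\in s^1$ or $\overline{j+1}\in s^2$; $\#(s^2\cap\langle\overline{j-1-2k},\overline{j-2}\rangle)\ge k$ for $k\in\{1,\dots,\frac{\overline{j-i}-3}2\}$; and $\#(s^2\cap\langle\overline{i+2},\overline{j-2}\rangle)=\frac{\overline{j-i}-3}2$ when $\overline j\neq\overline{i+1}$. *)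

(* Defs.v *)
From HB Require Import structures.
From mathcomp Require Import all_boot all_order all_algebra.
From mathcomp Require Import boolp classical_sets cardinality.

Set Implicit Arguments.
Unset Strict Implicit.
Unset Printing Implicit Defensive.

Import Order.TTheory GRing.Theory Num.Theory.
Local Open Scope classical_set_scope.
Local Open Scope ring_scope.

(* Z[q^{1/2}, q^{-1/2}], realized inside the fraction field of {poly int},
   with 'X playing the role of q^{1/2}. *)
Definition is_laurent : {pred {fraction {poly int}}} :=
  fun f => `[< exists (p : {poly int}) (k : nat),
                 f = tofrac p / tofrac ('X ^+ k) >].

Lemma is_laurent_subring : subring_closed is_laurent.
Proof.
have X0 k : tofrac ('X ^+ k : {poly int}) != 0.
  by rewrite tofrac_eq0 expf_neq0 // polyX_eq0.
split.
- by apply/asboolP; exists 1, 0%N; rewrite expr0 divrr // unitfE tofrac1 oner_eq0.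
- move=> f g /asboolP[p [k ->]] /asboolP[r [l ->]]; apply/asboolP.
  exists (p * 'X^l - r * 'X^k), (k + l)%N.
  by rewrite -mulNr addf_div // exprD -tofracN !tofracM tofracB !tofracM tofracN mulNr.
- move=> f g /asboolP[p [k ->]] /asboolP[r [l ->]]; apply/asboolP.
  by exists (p * r), (k + l)%N; rewrite mulf_div exprD !tofracM.
Qed.

HB.instance Definition _ :=
  GRing.isSubringClosed.Build _ is_laurent is_laurent_subring.

Record laurent := Laurent {
  laurent_val :> {fraction {poly int}};
  laurent_valP : laurent_val \in is_laurent }.

HB.instance Definition _ := [isSub for laurent_val].
HB.instance Definition _ := [Choice of laurent by <:].
HB.instance Definition _ := [SubChoice_isSubComNzRing of laurent by <:].

(* [bar n k] is the element of {1, ..., n} congruent to k modulo n (n > 0). *)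
Definition bar (n : nat) (k : int) : nat := (`|((k - 1) %% n%:Z)%Z|%N).+1.

(* The cyclic interval <a, b>, for a and b in {1, ..., n}. *)
Definition cyc (n a b : nat) : seq nat :=
  if a == bar n (b%:Z + 1) then [::]
  else [seq bar n (a%:Z + k%:Z) | k <- iota 0 (bar n (b%:Z - a%:Z + 1))].

Definition label (n : nat) := {k : nat | (0 < k <= n)%N}.

Record labeled_graph (n : nat) := LabeledGraph {
  vertex : Type;
  weight : vertex -> vertex -> laurent;
  tau : vertex -> set (label n);
  locally_finite : forall u,
    finite_set [set v | weight u v != 0 \/ weight v u != 0] }.

Section SimpleUnderlyingGraph.
Variables (n : nat) (G : labeled_graph n).

Definition simple_weight (u v : vertex G) : laurent :=
  if (weight u v == 1) && (weight v u == 1) then 1 else 0.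

Lemma simple_weight_locally_finite u :
  finite_set [set v | simple_weight u v != 0 \/ simple_weight v u != 0].
Proof.
apply: sub_finite_set (locally_finite u) => v [H|H]; rewrite /simple_weight in H.
- left; move: H; case: ifP => [/andP[/eqP e _] _|_ H].
    by rewrite e; exact: oner_neq0.
  by exfalso; move/eqP: H; apply.
- right; move: H; case: ifP => [/andP[/eqP e _] _|_ H].
    by rewrite e; exact: oner_neq0.
  by exfalso; move/eqP: H; apply.
Qed.

Definition simple_underlying : labeled_graph n :=
  LabeledGraph (tau (l:=G)) simple_weight_locally_finite.

End SimpleUnderlyingGraph.

(* A filling is the list of its rows, from top to bottom. *)
Definition is_rsyt (n : nat) (lam : seq nat) (T : seq (seq nat)) : bool :=
  [&& shape T == lam, perm_eq (flatten T) (iota 1 n) & all (sorted ltn) T].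

Definition rsyt (n : nat) (lam : seq nat) :=
  {T : seq (seq nat) | is_rsyt n lam T}.

Lemma rsyt_finite n lam (A : set (rsyt n lam)) : finite_set A.
Proof.
apply: (@sub_finite_set _ _
  [set` pmap (insub : _ -> option (rsyt n lam))
        [seq reshape lam s | s <- permutations (iota 1 n)]]).
  move=> T _ /=; rewrite mem_pmap_sub.
  case/and3P: (valP T) => /eqP sT pT _.
  apply/mapP; exists (flatten (val T)); first by rewrite mem_permutations.
  by rewrite -{1}(flattenK (val T)) sT.
exact: finite_seq.
Qed.

Section Tableaux.
Variables (n : nat) (lam : seq nat).
Implicit Types T S : rsyt n lam.

(* [row T 0] is the top row T^1 and [row T 1] is T^2. *)
Definition row T (r : nat) : seq nat := nth [::] (val T) r.

Definition row_of T (i : nat) : nat := find (fun r : seq nat => i \in r) (val T).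

(* [interchange a b T S]: S is obtained from T by interchanging the entries
   a and b and then sorting the rows. *)
Definition interchange (a b : nat) T S : Prop :=
  val S = [seq sort leq [seq [fun z => z with a |-> b, b |-> a] x | x <- r]
          | r <- val T].

Definition des T : set (label n) :=
  [set i | (row_of T (val i) < row_of T (bar n ((val i)%:Z + 1)))%N].

Definition knuth_move T S : Prop :=
  [/\ ~ (des T `<=` des S), ~ (des S `<=` des T) &
      exists i : int, interchange (bar n i) (bar n (i + 1)) T S].

End Tableaux.

Definition indicator (P : Prop) : laurent := if `[< P >] then 1 else 0.

Definition affine_DEG (n : nat) (lam : seq nat) : labeled_graph n :=
  @LabeledGraph n (rsyt n lam) (fun u v => indicator (knuth_move u v))
    (@des n lam) (fun u => rsyt_finite _).

Section TwoRowGraph.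
Variables (n : nat) (lam : seq nat).
Implicit Types s t : rsyt n lam.

Definition first_kind s t : Prop :=
  exists i : int, [/\ bar n i \in row s 0, bar n (i + 1) \in row s 1 &
    interchange (bar n i) (bar n (i + 1)) s t].

(* #(s^2 cap <a, b>); the entries of a row are distinct. *)
Definition row2_count s (a b : nat) : nat :=
  count (fun x => x \in cyc n a b) (row s 1).

Definition second_kind_cond s (i j : int) : Prop :=
  [/\ bar n i != bar n (j + 1),
      odd (bar n (j - i)),
      bar n (i + 1) \in row s 0 /\ bar n (j - 1) \in row s 1,
      bar n (i - 1) \in row s 0 \/ bar n (j + 1) \in row s 1 &
      (forall k : nat, (1 <= k)%N ->
         k%:Z <= (((bar n (j - i))%:Z - 3) %/ 2)%Z ->
         (k <= row2_count s (bar n (j - 1 - 2 * k%:Z)) (bar n (j - 2)))%N) /\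
      (bar n j != bar n (i + 1) ->
         (row2_count s (bar n (i + 2)) (bar n (j - 2)))%:Z =
         (((bar n (j - i))%:Z - 3) %/ 2)%Z)].

Definition second_kind s t : Prop :=
  exists i j : int, [/\ bar n i \in row s 1, bar n j \in row s 0,
    interchange (bar n i) (bar n j) s t & second_kind_cond s i j].

Definition Gamma : labeled_graph n :=
  @LabeledGraph n (rsyt n lam)
    (fun s t => indicator (first_kind s t \/ second_kind s t))
    (@des n lam) (fun u => rsyt_finite _).

End TwoRowGraph.

(* Main.v *)
Require Import Defs.
From mathcomp Require Import all_boot all_order all_algebra.
From mathcomp Require Import boolp classical_sets.

(** A two-row tableau is determined by which residues modulo [n] lie in the
    bottom row (the low ones). If [S] arises from [T] by exchanging [i] in the top row with
    [i + 1] in the bottom row, then passing from [T] to [S] loses the descent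
    [i] and can only gain [i - 1] or [i + 1]; so it is a Knuth move iff [i - 1]
    is high or [i + 2] is low, which is also what the arrow of second kind from
    [S] to [T] requires. Two opposite arrows of the first kind would force
    [n] to divide 2, and for two opposite arrows of the second kind the one
    requires [i - 1] low and [j + 1] high while the other forbids it. *)

Set Implicit Arguments.
Unset Strict Implicit.
Unset Printing Implicit Defensive.

Import Order.TTheory GRing.Theory Num.Theory.

(** * Residues modulo [n] and their representatives *)

Section Residues.
Local Open Scope ring_scope.
Variables (n : nat) (n_gt0 : (0 < n)%N).
Implicit Types k l m : int.

Lemma bar_modz k : (bar n k)%:Z = ((k - 1) %% n%:Z)%Z + 1.
Proof.
by rewrite /bar intS addrC gez0_abs // modz_ge0 // eqz_nat -lt0n.
Qed.

Lemma bar_range k : (0 < bar n k <= n)%N.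
Proof.
by rewrite /bar /= -ltz_nat gez0_abs ?modz_ge0 ?ltz_pmod // eqz_nat -lt0n.
Qed.

Lemma eq_bar k l : (bar n k == bar n l) = (n%:Z %| k - l)%Z.
Proof.
rewrite -eqz_nat !bar_modz (inj_eq (addIr 1)) eqz_mod_dvd.
by rewrite opprB addrA subrK.
Qed.

Lemma bar_small (x : nat) : (0 < x <= n)%N -> bar n x%:Z = x.
Proof.
case: x => // x /= lt_xn; by rewrite /bar intS addrC addKr modz_small.
Qed.

Lemma bar_shift m k l : bar n k = bar n l -> bar n (k + m) = bar n (l + m).
Proof.
by move/eqP; rewrite eq_bar => d; apply/eqP; rewrite eq_bar opprD addrACA subrr addr0.
Qed.

Lemma bar_shift_neq (m : nat) k : (0 < m < n)%N -> bar n (k + m%:Z) != bar n k.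
Proof.
case/andP=> m0 mn; rewrite eq_bar addrAC subrr add0r dvdzE /= gtnNdvd //.
Qed.

End Residues.

(** Local finiteness is a proposition, so proof irrelevance leaves only the weights to compare. *)
Lemma labeled_graph_ext (n : nat) (V : Type) (w w' : V -> V -> laurent)
    (t : V -> set (label n)) lf lf' :
  w = w' -> @LabeledGraph n V w t lf = @LabeledGraph n V w' t lf'.
Proof.
by move=> e; move: lf lf'; rewrite e => lf lf'; rewrite (Prop_irrelevance lf lf').
Qed.

Lemma swap_entriesK (a b : nat) :
  involutive [fun z : nat => z with a |-> b, b |-> a].
Proof.
move=> z /=; case: (eqVneq z a) => [->|za]; first by case: eqP => // _; rewrite eqxx.
by case: (eqVneq z b) => [->|zb]; rewrite ?eqxx // (negbTE za) (negbTE zb).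
Qed.

(** * Two-row tableaux as sets of low residues *)

Section TwoRows.
Local Open Scope ring_scope.
Variables (n l1 l2 : nat) (n_ge3 : (3 <= n)%N).
Implicit Types (S T : rsyt n [:: l1; l2]) (k i j : int).

Let n_gt0 : (0 < n)%N. Proof. exact: leq_trans n_ge3. Qed.

Definition low T k : bool := bar n k \in Defs.row T 1.

Lemma rsyt_rows T : val T = [:: Defs.row T 0; Defs.row T 1].
Proof.
rewrite /row; case: T => -[|a [|b [|c r]]] //= /and3P[/eqP //].
Qed.

(** The two rows together permute [1, ..., n], so they are disjoint and cover every residue. *)
Lemma mem_top T k : (bar n k \in Defs.row T 0) = ~~ low T k.
Proof.
have := valP T; rewrite /is_rsyt rsyt_rows => /and3P[_ + _].
rewrite /= cats0 => pT; have := perm_uniq pT; have := perm_mem pT (bar n k).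
rewrite iota_uniq cat_uniq mem_cat mem_iota add1n ltnS bar_range // /low.
move=> + /and3P[_ /hasPn disj _].
case: (boolP (bar n k \in Defs.row T 1)) => [/disj /= /negbTE-> //|_].
by rewrite orbF.
Qed.

Lemma eq_low T k l : bar n k = bar n l -> low T k = low T l.
Proof. by rewrite /low => ->. Qed.

(** The boolean is coerced to the row index, 0 or 1. *)
Lemma row_ofE T k : row_of T (bar n k) = low T k.
Proof.
by rewrite /row_of rsyt_rows /= mem_top -/(low T k); case: (low T k).
Qed.

Lemma des_low T (x : label n) k : val x = bar n k ->
  des T x <-> ~~ low T k && low T (k + 1).
Proof.
move=> xk; rewrite /des /= xk (@bar_shift n n_gt0 1 _ k) ?bar_small ?bar_range //.
by rewrite !row_ofE; case: (low T k); case: (low T (k + 1)).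
Qed.

Lemma des_subset T S :
  (des T `<=` des S)%classic <->
  (forall k, ~~ low T k && low T (k + 1) -> ~~ low S k && low S (k + 1)).
Proof.
split=> [sTS k|sTS x].
  have xk : val (exist _ (bar n k) (bar_range n_gt0 k) : label n) = bar n k by [].
  by move/(des_low T xk)/sTS/(des_low S xk).
have xk : val x = bar n (val x)%:Z by rewrite bar_small // (valP x).
by move/(des_low T xk)/sTS/(des_low S xk).
Qed.

(** * Exchanging two entries *)

Lemma interchange_low T S i j k :
  Defs.interchange (bar n i) (bar n j) T S ->
  low S k =
    if bar n k == bar n i then low T j
    else if bar n k == bar n j then low T i else low T k.
Proof.
rewrite /Defs.interchange !rsyt_rows => -[_ S1]; rewrite /low S1 mem_sort.
(* As the swap is its own inverse, an entry lies in the new row iff its swap lies in the old one. *)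
rewrite -{1}(swap_entriesK (bar n i) (bar n j) (bar n k)) mem_map; last first.
  exact: can_inj (swap_entriesK _ _).
by rewrite /=; do 2![case: ifP => // _].
Qed.

(** Swapping twice restores each row up to order, and a sorted row is determined by its entries. *)
Lemma interchange_sym a b T S : Defs.interchange a b T S -> Defs.interchange a b S T.
Proof.
rewrite /Defs.interchange => ->; rewrite -map_comp -[LHS]map_id.
apply/eq_in_map => r rT /=.
have r_sorted : sorted leq r.
  have /and3P[_ _ /allP/(_ r rT)] := valP T.
  by apply: sub_sorted => x y /ltnW.
apply: (sorted_eq leq_trans anti_leq r_sorted); first exact: (sort_sorted leq_total).
rewrite perm_sym perm_sort.
apply: (perm_trans (perm_map _ (permEl (perm_sort leq _)))).
by rewrite -map_comp map_id_in // => x _; exact: swap_entriesK.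
Qed.

(** An arrow of the first kind with its index exposed: [i + 1] rises to the top row. *)
Definition raises T S i : Prop :=
  [/\ ~~ low T i, low T (i + 1) & Defs.interchange (bar n i) (bar n (i + 1)) T S].

Definition has_high_left_or_low_right T i := ~~ low T (i - 1) || low T (i + 2).

Lemma bar_succ_neq k : bar n (k + 1) != bar n k.
Proof. by apply: (@bar_shift_neq n n_gt0 1); rewrite (ltn_trans _ n_ge3). Qed.

Lemma bar_succ2_neq k : bar n (k + 2) != bar n k.
Proof. exact: (@bar_shift_neq n n_gt0 2). Qed.

Lemma raises_low T S i k : raises T S i ->
  low S k = (bar n k == bar n i) || (bar n k != bar n (i + 1)) && low T k.
Proof.
case=> /negbTE Ti Ti1 /interchange_low ->; rewrite Ti Ti1.
by case: ifP => // _; case: ifP.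
Qed.

(** Since [n >= 3], neither [i - 1] nor [i + 2] is congruent to [i] or [i + 1]. *)
Lemma raises_low_out T S i : raises T S i ->
  (low S (i - 1) = low T (i - 1)) * (low S (i + 2) = low T (i + 2)).
Proof.
move=> r; rewrite !(raises_low _ r).
have := bar_succ_neq (i - 1); rewrite subrK eq_sym => /negbTE ->.
have := bar_succ2_neq (i - 1); rewrite (_ : i - 1 + 2 = i + 1); last first.
  by rewrite -addrA; congr (_ + _).
rewrite eq_sym => ->; rewrite (negbTE (bar_succ2_neq i)).
by have := bar_succ_neq (i + 1); rewrite -addrA => ->.
Qed.

(** * Knuth moves *)

Lemma knuth_move_sym T S : knuth_move T S -> knuth_move S T.
Proof. by case=> ? ? [i /interchange_sym ?]; split=> //; exists i. Qed.

(** Exchanging two entries of one row would leave the low residues, hence the descents, unchanged,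
    against incomparability. *)
Lemma knuth_move_raises T S : knuth_move T S ->
  exists i, raises T S i \/ raises S T i.
Proof.
case=> nTS _ [i ex]; exists i.
have Si : low S i = low T (i + 1) by rewrite (interchange_low _ ex) eqxx.
have Si1 : low S (i + 1) = low T i.
  by rewrite (interchange_low _ ex) (negbTE (bar_succ_neq i)) eqxx.
have Ti : low T i != low T (i + 1).
  apply/eqP => eT; have sTS k : low S k = low T k.
    rewrite (interchange_low _ ex); case: eqP => [/eq_low->//|_].
    by case: eqP => [/eq_low->|_].
  by apply: nTS; apply/des_subset => k; rewrite !sTS.
move: Ti; case: (boolP (low T i)) => Ti; case: (boolP (low T (i + 1))) => // Ti1 _.
- by right; split; rewrite ?Si ?Si1 //; exact: interchange_sym.
- by left; split.
Qed.

Lemma knuth_moveE T S i : raises T S i ->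
  knuth_move T S <-> has_high_left_or_low_right T i.
Proof.
move=> r; have [Ti Ti1 ex] := r; have [outl outr] := raises_low_out r.
have Si : low S i by rewrite (raises_low _ r) eqxx.
have Si1 : ~~ low S (i + 1).
  by rewrite (raises_low _ r) eqxx (negbTE (bar_succ_neq i)).
split=> [[_ nST _]|T_out].
  (* With [i - 1] low and [i + 2] high, neither [i - 1] nor [i + 1] is a descent of [S], so [S]
     gains none. *)
  apply/contraT; rewrite negb_or negbK => /andP[Tl Tr]; case: nST.
  apply/des_subset => k /andP[]; rewrite !(raises_low _ r).
  case: (eqVneq (bar n k) (bar n i)) => [//|ki] /=.
  case: (eqVneq (bar n k) (bar n (i + 1))) => [ki1 _|ki1 /= Tk] /=.
    have e : bar n (k + 1) = bar n (i + 2) by rewrite (bar_shift n_gt0 1 ki1) -addrA.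
    by rewrite e (negbTE (bar_succ2_neq i)) (eq_low T e) (negbTE Tr) andbF.
  case: (eqVneq (bar n (k + 1)) (bar n i)) => [k1i _|_ /andP[_ ->]]; last by rewrite Tk.
  have e : bar n k = bar n (i - 1) by rewrite -(bar_shift n_gt0 (-1) k1i) addrK.
  by rewrite (eq_low T e) Tl in Tk.
split; last by exists i.
  by move/des_subset/(_ i); rewrite Ti Ti1 Si => /(_ isT).
(* A high [i - 1] makes [i - 1] a new descent of [S]; a low [i + 2] makes [i + 1] one. *)
case/orP: T_out => [Tl|Tr] /des_subset.
  by move/(_ (i - 1)); rewrite outl subrK Si Tl (negbTE Ti) => /(_ isT).
by move/(_ (i + 1)); rewrite -addrA outr Si1 Tr Ti1 => /(_ isT).
Qed.

(** * Arrows of the two kinds *)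

Lemma first_kindP T S : first_kind T S <-> exists i, raises T S i.
Proof.
split=> -[i]; first by rewrite mem_top => -[Ti Ti1 ex]; exists i.
by case=> Ti Ti1 ex; exists i; rewrite mem_top.
Qed.

(** What rose must sink and conversely, so [j = i + 1] and [j + 1 = i] modulo [n]. *)
Lemma raises_asym T S i j : raises T S i -> ~ raises S T j.
Proof.
move=> rT rS; have [Ti Ti1 _] := rT; have [Sj Sj1 _] := rS.
have e : bar n j = bar n (i + 1).
  move: (Sj) Ti1; rewrite (raises_low (i + 1) rS) => /negP nSj.
  rewrite (raises_low (i + 1) rT) eqxx (negbTE (bar_succ_neq i)) /= andbF orbF.
  by move/eqP.
have : low T (j + 1) = false by rewrite (raises_low _ rS) eqxx (negbTE (bar_succ_neq j)).
have := Sj1; rewrite (raises_low _ rT) => /orP[|/andP[_ ->//]].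
rewrite (bar_shift n_gt0 1 e) -addrA.
by rewrite (negbTE (bar_succ2_neq i)).
Qed.

Lemma second_kindE T S i : raises T S i ->
  second_kind S T <-> has_high_left_or_low_right T i.
Proof.
move=> r; have [Ti Ti1 ex] := r; have [outl outr] := raises_low_out r.
have Si : low S i by rewrite (raises_low _ r) eqxx.
have Si1 : ~~ low S (i + 1).
  by rewrite (raises_low _ r) eqxx (negbTE (bar_succ_neq i)).
split.
  case=> i' [j' []]; rewrite -/(low S i') mem_top => Si' Sj' ex' [_ _ _ + _].
  rewrite mem_top -/(low S (j' + 1)).
  have Ti' : ~~ low T i' by rewrite (interchange_low _ ex') eqxx.
  have Tj' : low T j'.
    by rewrite (interchange_low _ ex') eqxx; case: eqP => [/(eq_low S)->|_].
  have ei : bar n i' = bar n i.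
    by move: Si'; rewrite (raises_low _ r) (negbTE Ti') andbF orbF => /eqP.
  (* Only [i] and [i + 1] change rows between [T] and [S], which pins down the indices of the
     arrow. *)
  have ej : bar n j' = bar n (i + 1).
    by move: Sj'; rewrite (raises_low _ r) Tj' andbT negb_or negbK => /andP[_ /eqP].
  rewrite (eq_low S (bar_shift n_gt0 (-1) ei)) (eq_low S (bar_shift n_gt0 1 ej)).
  by rewrite -addrA outl outr => -[h|h]; apply/orP; [left|right].
move=> T_out; exists i, (i + 1); split=> //; [by rewrite mem_top | exact: interchange_sym |].
(* For [j = i + 1] the distance is 1, and [(1 - 3) %/ 2] is negative: no [k >= 1] is left to check,
   and the final count is not imposed. *)
have bar1 : bar n 1 = 1%N by rewrite bar_small // n_gt0.
rewrite /second_kind_cond !(addrAC i 1) subrr add0r bar1; split=> //.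
- by rewrite -addrA eq_sym bar_succ2_neq.
- by rewrite mem_top subrK.
- rewrite mem_top -addrA -/(low S (i + 2)) outl outr.
  by case/orP: T_out; [left|right].
- by split=> [k k_gt0|]; rewrite ?eqxx.
Qed.

(** Both arrows exchange the same residues, so [i' = j] and [j' = i] modulo [n]. As [i] differs from
    [j + 1], the exchange does not touch [i - 1] and [j + 1], so the two conditions on them can be
    compared. *)
Lemma second_kind_asym T S : second_kind T S -> ~ second_kind S T.
Proof.
case=> i [j [Ti Tj exT [ij1 _ _ outT _]]] [i' [j' [Si' Sj' exS [ij1' _ [Si'1 Sj'1] _ _]]]].
move: Tj Sj' outT Si'1; rewrite !mem_top -/(low T (j + 1)) => Tj Sj' outT Si'1.
have Ti' : ~~ low T i' by rewrite (interchange_low _ exS) eqxx.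
have Tj' : low T j'.
  by rewrite (interchange_low _ exS) eqxx; case: eqP => [/(eq_low S)->|_].
have ei : bar n i' = bar n j.
  move: Si'; rewrite -/(low S i') (interchange_low _ exT) (negbTE Tj) (negbTE Ti').
  by case: eqP => // _; case: eqP.
have ej : bar n j' = bar n i.
  move: Sj'; rewrite (interchange_low _ exT) Tj'.
  by case: eqP => // _; case: eqP => // _; rewrite (Ti : low T i).
have i1j : bar n (i - 1) != bar n j.
  by apply: contra ij1 => /eqP/(bar_shift n_gt0 1); rewrite subrK => ->.
have i1i : bar n (i - 1) != bar n i.
  by have := bar_succ_neq (i - 1); rewrite subrK eq_sym.
have eSl : low S (i - 1) = low T (i - 1).
  by rewrite (interchange_low _ exT) (negbTE i1i) (negbTE i1j).
have eSr : low S (j + 1) = low T (j + 1).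
  by rewrite (interchange_low _ exT) eq_sym (negbTE ij1) (negbTE (bar_succ_neq j)).
move: Si'1 Sj'1 outT; rewrite -/(low S (j' - 1)).
rewrite (eq_low S (bar_shift n_gt0 1 ei)) (eq_low S (bar_shift n_gt0 (-1) ej)).
by rewrite eSl eSr => /negbTE-> ->; case.
Qed.

Lemma arrows_knuth_move T S :
  ((first_kind T S \/ second_kind T S) /\ (first_kind S T \/ second_kind S T)) <->
  knuth_move T S.
Proof.
split=> [[[fT|sT] [fS|sS]]|kTS].
- case/first_kindP: fT => i rT; case/first_kindP: fS => j rS.
  by case: (raises_asym rT rS).
- by case/first_kindP: fT => i rT; apply/(knuth_moveE rT)/(second_kindE rT).
- case/first_kindP: fS => i rS; apply: knuth_move_sym.
  exact/(knuth_moveE rS)/(second_kindE rS).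
- by case: (second_kind_asym sT sS).
(* The direction that raises [i + 1] is of the first kind, its reverse of the second. *)
- have [i [rT|rS]] := knuth_move_raises kTS.
    split; [left; apply/first_kindP; by exists i|right].
    exact/(second_kindE rT)/(knuth_moveE rT).
  split; [right|left; apply/first_kindP; by exists i].
  exact/(second_kindE rS)/(knuth_moveE rS)/knuth_move_sym.
Qed.

End TwoRows.

(** * Comparison of the weights *)

Lemma indicator_eq1 (P : Prop) : (indicator P == 1%R) = `[< P >].
Proof. by rewrite /indicator; case: asboolP; rewrite ?eqxx // eq_sym oner_eq0. Qed.

Theorem proposition4p8 (n l1 l2 : nat) (n_ge3 : (3 <= n)%N)
  (l2_ge1 : (1 <= l2)%N) (l2_le_l1 : (l2 <= l1)%N)
  (lam_n : (l1 + l2)%N = n) :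
  simple_underlying (Gamma n [:: l1; l2]) = affine_DEG n [:: l1; l2].
Proof.
apply: labeled_graph_ext; apply/funext => T; apply/funext => S.
rewrite /simple_weight /= !indicator_eq1 -asbool_and /indicator.
by rewrite (propext (arrows_knuth_move n_ge3 T S)).
Qed.
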